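(* For every positive integer $n$, the chromatic number problem for $(2K_2,P_4\vee K_n)$-free graphs is polynomial time solvable.
   Context: All graphs are finite and simple. $P_n$ and $K_n$ denote the path and the complete graph on $n$ vertices; $2K_2$ is the disjoint union of two copies of $K_2$; $G\vee H$ is obtained from the disjoint union of $G$ and $H$ by adding an edge between every vertex of $G$ and every vertex of $H$. A graph is $(H_1,H_2)$-free if it has no induced subgraph isomorphic to $H_1$ or to $H_2$. The chromatic number problem for a graph family $\mathcal{G}$ is: given an input graph $G\in\mathcal{G}$, determine its chromatic number $\chi(G)$. Here $n$ is fixed, and polynomial time is measured in the size of the input graph. *)

(* Defs.v *)
From HB Require Import structures.
From mathcomp Require Import all_boot all_order all_algebra.

Set Implicit Arguments.
Unset Strict Implicit.
Unset Printing Implicit Defensive.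

(* Finite simple graphs. *)

Record sgraph := SGraph {
  vertex :> finType;
  adj : rel vertex;
  adj_sym : symmetric adj;
  adj_irr : irreflexive adj }.

Definition complete_adj n : rel 'I_n := fun i j => i != j.

Lemma complete_sym n : symmetric (@complete_adj n).
Proof. by move=> i j; rewrite /complete_adj eq_sym. Qed.

Lemma complete_irr n : irreflexive (@complete_adj n).
Proof. by move=> i; rewrite /complete_adj eqxx. Qed.

Definition complete n := SGraph (@complete_sym n) (@complete_irr n).

Definition path_adj n : rel 'I_n :=
  fun i j => (i.+1 == j :> nat) || (j.+1 == i :> nat).

Lemma path_sym n : symmetric (@path_adj n).
Proof. by move=> i j; rewrite /path_adj orbC. Qed.

Lemma path_irr n : irreflexive (@path_adj n).
Proof. by move=> i; rewrite /path_adj orbb gtn_eqF. Qed.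

Definition path_graph n := SGraph (@path_sym n) (@path_irr n).

(* [cross] tells whether vertices on different sides are adjacent. *)
Definition sum_adj (G H : sgraph) (cross : bool) : rel (G + H)%type :=
  fun u v => match u, v with
  | inl x, inl y => adj x y
  | inr x, inr y => adj x y
  | _, _ => cross
  end.

Lemma sum_sym G H cross : symmetric (@sum_adj G H cross).
Proof. by move=> [x|x] [y|y] //=; apply: adj_sym. Qed.

Lemma sum_irr G H cross : irreflexive (@sum_adj G H cross).
Proof. by move=> [x|x] /=; apply: adj_irr. Qed.

Definition disjoint_union G H :=
  SGraph (@sum_sym G H false) (@sum_irr G H false).

Definition graph_join G H :=
  SGraph (@sum_sym G H true) (@sum_irr G H true).

Definition induced_adj (G : sgraph) (S : {set G}) : rel {x | x \in S} :=
  fun u v => adj (val u) (val v).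

Lemma induced_sym (G : sgraph) (S : {set G}) : symmetric (@induced_adj G S).
Proof. by move=> u v; apply: adj_sym. Qed.

Lemma induced_irr (G : sgraph) (S : {set G}) : irreflexive (@induced_adj G S).
Proof. by move=> u; apply: adj_irr. Qed.

Definition induced (G : sgraph) (S : {set G}) :=
  SGraph (@induced_sym G S) (@induced_irr G S).

Definition isomorphic (G H : sgraph) : Prop :=
  exists2 f : G -> H, bijective f & forall x y, adj (f x) (f y) = adj x y.

Definition contains_induced (G H : sgraph) : Prop :=
  exists S : {set G}, isomorphic (induced S) H.

Definition pair_free (H1 H2 G : sgraph) : Prop :=
  ~ contains_induced G H1 /\ ~ contains_induced G H2.

Definition colorable (G : sgraph) (k : nat) : bool :=
  [exists c : {ffun G -> 'I_k}, forall x, forall y, adj x y ==> (c x != c y)].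

Lemma colorable_ex G : exists k, colorable G k.
Proof.
exists #|G|; apply/existsP; exists [ffun x => enum_rank x].
apply/forallP=> x; apply/forallP=> y; apply/implyP=> xy; rewrite !ffunE.
by apply/eqP=> /enum_rank_inj exy; rewrite exy adj_irr in xy.
Qed.

Definition chromatic_number (G : sgraph) : nat := ex_minn (colorable_ex G).

(* Polynomial time is measured on a random access machine in the style of Cook
   and Reckhow, with registers [reg] and an indirectly addressed memory [mem],
   both indexed by nat and holding natural numbers. Every instruction costs
   one step. Numbers only grow through additions, so that after t steps they
   have O(t + log(input)) bits; unit cost is therefore polynomially equivalent
   to logarithmic cost and to Turing machine time. *)

Inductive instr :=
| IConst of nat & nat         (* IConst i c : reg[i] := c *)
| IAdd of nat & nat & nat     (* IAdd i j k : reg[i] := reg[j] + reg[k] *)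
| ISub of nat & nat & nat     (* ISub i j k : reg[i] := reg[j] - reg[k], or 0 *)
| IRead of nat & nat          (* IRead i j  : reg[i] := mem[reg[j]] *)
| IWrite of nat & nat         (* IWrite i j : mem[reg[i]] := reg[j] *)
| IJump of nat & nat.         (* IJump i l  : if reg[i] <> 0, go to line l *)

Definition program := seq instr.

Record config := Config { pc : nat; reg : nat -> nat; mem : nat -> nat }.

Definition exec (a : instr) (s : config) : config :=
  let: Config l r m := s in
  match a with
  | IConst i c => Config l.+1 [eta r with i |-> c] m
  | IAdd i j k => Config l.+1 [eta r with i |-> r j + r k] m
  | ISub i j k => Config l.+1 [eta r with i |-> r j - r k] m
  | IRead i j => Config l.+1 [eta r with i |-> m (r j)] m
  | IWrite i j => Config l.+1 r [eta m with r i |-> r j]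
  | IJump i l' => Config (if r i != 0 then l' else l.+1) r m
  end.

(* The machine halts, and stays put, once [pc] points outside the program. *)
Definition halted (p : program) (s : config) : bool := size p <= pc s.

Definition step (p : program) (s : config) : config :=
  if onth p (pc s) is Some a then exec a s else s.

Definition run (p : program) (t : nat) (s : config) : config :=
  iter t (step p) s.

(* A graph is given by its number of vertices and its adjacency matrix, in
   row-major order. The order of the vertices is the enumeration carried by
   the vertex type, hence arbitrary as [G] ranges over [sgraph]. *)

Definition adjacency_matrix (G : sgraph) : seq nat :=
  [seq nat_of_bool (adj x y) | x <- enum G, y <- enum G].

Definition input_config (G : sgraph) : config :=
  Config 0 [eta (fun=> 0) with 0 |-> #|G|] (nth 0 (adjacency_matrix G)).

Definition polytime_on (F : sgraph -> Prop) (f : sgraph -> nat) : Prop :=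
  exists (p : program) (q : {poly nat}), forall G : sgraph, F G ->
  exists t : nat, let s := run p t (input_config G) in
    [/\ t <= q.[#|G|]%R, halted p s & reg s 0 = f G].

Definition chromatic_number_polytime (F : sgraph -> Prop) : Prop :=
  polytime_on F chromatic_number.

(* Main.v *)
Require Import Defs.
From HB Require Import structures.
From mathcomp Require Import all_boot all_order all_algebra.
From mathcomp Require Import zify.

(** Let [G] be a (2K_2, P_4 v K_n)-free graph, put [m = 4 n + 4], and suppose first that
    [G] has a clique with [m] vertices. Then the chromatic number of [G] equals its clique
    number. To see this, take a maximum clique [K] and, among the maximum cliques, one of
    largest degree sum. The vertices of [K] serve as colours, and a vertex [v] may only
    receive a colour from [miss v], the set of clique vertices not adjacent to [v]. If [u] and
    [v] are adjacent, then [miss u] and [miss v] share at most one colour, for lack of a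
    2K_2; and if they do share one, then [u], [v] and two clique vertices induce a P_4, so
    fewer than [n] clique vertices are adjacent to all of it and [miss u], [miss v] nearly
    cover [K] ([miss_meet]). Hence vertices with short lists never conflict, and the main
    lemma [private_miss] gives every vertex with a long list a colour that no neighbour
    could ever use.

    The clique number itself is found by counting. The vertices with at most one
    non-neighbour in a given clique with [m] vertices induce a P_4-free graph, in which
    the neighbourhoods of two non-adjacent vertices are nested; one representative for each
    class of non-adjacent vertices with maximal neighbourhood gives a maximum clique
    of this subgraph ([leq_card_top_rep]). If the given clique is part of [K], then the
    subgraph contains [K]; so the largest number of representatives, over all choices
    of the given clique, is the clique number.

    If [G] has no clique with [m] vertices, then it has a colouring with [3 ^ m] colours
    ([colorable_bounded_clique]), so it is enough to decide [k]-colourability for boundedly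
    many [k]. In a colouring that prefers small colours, for [i < j] some vertex of colour
    [i] is adjacent to all vertices of colour [j], and such vertices, one for each pair
    [(i, j)], determine the colouring ([colorable_classes]). So it is enough to try
    all choices of [k ^ 2] vertices.

    So the chromatic number is the value of a fixed expression built from constants, the order,
    adjacency, addition, subtraction, and sums and maxima over all vertices
    ([chromatic_term]). Every such expression compiles to nested loops of fixed depth
    over the vertices, whose running time is a polynomial in the number of vertices
    ([compile_correct], [time_poly]). *)

Set Implicit Arguments.
Unset Strict Implicit.
Unset Printing Implicit Defensive.

(** * Forbidden induced subgraphs *)

Section Graph.
Variable G : sgraph.
Implicit Types (u v a b c d : G) (A K Q : {set G}).

Definition clique K : bool :=
  [forall u in K, forall v in K, (u != v) ==> adj u v].

Definition two_K2_free : Prop := forall a b c d,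
  adj a b -> adj c d -> [|| adj a c, adj a d, adj b c | adj b d].

Definition induced_P4 a b c d : bool :=
  [&& adj a b, adj b c, adj c d, ~~ adj a c, ~~ adj a d & ~~ adj b d].

Definition P4_join_free n : Prop := forall a b c d K,
  induced_P4 a b c d -> clique K ->
  {in K, forall x, [&& adj a x, adj b x, adj c x & adj d x]} -> #|K| < n.

Lemma cliqueP K : reflect {in K &, forall u v, u != v -> adj u v} (clique K).
Proof.
apply: (iffP forall_inP) => [H u v uK vK uv|H u uK]; last first.
  by apply/forall_inP => v vK; apply/implyP; apply: H.
by have /forall_inP/(_ v vK)/implyP := H u uK; apply.
Qed.

Lemma contains_induced_of (H : sgraph) (phi : H -> G) :
  injective phi -> (forall x y, adj (phi x) (phi y) = adj x y) -> contains_induced G H.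
Proof.
move=> phi_inj phi_adj; exists (phi @: setT).
pose g (h : H) : {x | x \in phi @: setT} := exist _ (phi h) (imset_f phi (in_setT h)).
have g_bij : bijective g.
  apply: inj_card_bij => [x y /(congr1 val) /phi_inj //|].
  by rewrite card_sig (card_imset _ phi_inj) cardsT.
have [f gK fK] := g_bij; exists f; first by exists g.
by move=> x y; rewrite -{2}(fK x) -{2}(fK y) -phi_adj.
Qed.

Lemma adj_neq u v w : adj u w -> ~~ adj v w -> u != v.
Proof. by move=> uw; apply: contraNneq => <-. Qed.

Lemma two_K2_freeP :
  ~ contains_induced G (disjoint_union (complete 2) (complete 2)) -> two_K2_free.
Proof.
move=> free a b c d ab cd; apply/negPn/negP; rewrite !negb_or => /and4P[nac nad nbc nbd].
case: free; pose phi (x : 'I_2 + 'I_2) :=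
  match x with inl i => if i == ord0 then a else b | inr i => if i == ord0 then c else d end.
apply: (@contains_induced_of (disjoint_union (complete 2) (complete 2)) phi).
  have ne_ab : a != b by apply: (adj_neq ab); rewrite adj_irr.
  have ne_cd : c != d by apply: (adj_neq cd); rewrite adj_irr.
  have ne_ac : a != c by apply: (adj_neq ab); rewrite adj_sym.
  have ne_ad : a != d by apply: (adj_neq ab); rewrite adj_sym.
  have ne_bc : b != c by apply: (@adj_neq _ _ a); rewrite adj_sym.
  have ne_bd : b != d by apply: (@adj_neq _ _ a); rewrite adj_sym.
  move=> [[[|[|//]] xp]|[[|[|//]] xp]] [[[|[|//]] yp]|[[|[|//]] yp]] /= E.
  all: try first [by congr inl; apply: val_inj | by congr inr; apply: val_inj
             | by move: ne_ab ne_cd ne_ac ne_ad ne_bc ne_bd; rewrite E eqxx].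
move=> [[[|[|//]] xp]|[[|[|//]] xp]] [[[|[|//]] yp]|[[|[|//]] yp]] /=.
all: try by rewrite ?adj_irr ?ab ?cd.
all: try by apply/negbTE.
all: try by rewrite adj_sym ?ab ?cd.
all: try by rewrite adj_sym; apply/negbTE.
Qed.

Lemma P4_join_freeP n :
  ~ contains_induced G (graph_join (path_graph 4) (complete n)) -> P4_join_free n.
Proof.
move=> free a b c d K /and5P[ab bc cd nac /andP[nad nbd]] cK KP.
rewrite ltnNge; apply/negP => nK; apply: free.
pose q (i : 'I_n) : G := enum_val (widen_ord nK i).
have q_inj : injective q by move=> i j /enum_val_inj /(congr1 val) /= /val_inj.
have qK i : q i \in K by apply: enum_valP.
pose phi (x : 'I_4 + 'I_n) := match x with inl i => nth a [:: a; b; c; d] i | inr i => q i end.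
have pathP (i j : 'I_4) : adj (nth a [:: a; b; c; d] i) (nth a [:: a; b; c; d] j) = path_adj i j.
  case: i j => [[|[|[|[|//]]]] ?] [[|[|[|[|//]]]] ?]; rewrite /path_adj /=.
  all: try by rewrite ?adj_irr ?ab ?bc ?cd.
  all: try by apply/negbTE.
  all: try by rewrite adj_sym ?ab ?bc ?cd.
  all: try by rewrite adj_sym; apply/negbTE.
have crossP (i : 'I_4) j : adj (nth a [:: a; b; c; d] i) (q j).
  by have /and4P[aq bq cq dq] := KP _ (qK j); case: i => [[|[|[|[|//]]]] ?].
have phi_adj (x y : graph_join (path_graph 4) (complete n)) : adj (phi x) (phi y) = adj x y.
  case: x y => x [] y /=; rewrite ?pathP ?crossP // 1?adj_sym ?crossP //.
  rewrite /complete_adj; case: (eqVneq x y) => [->|ne]; first by rewrite adj_irr.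
  by apply: (cliqueP _ cK); rewrite ?qK ?(inj_eq q_inj) 1?eq_sym.
apply: (@contains_induced_of (graph_join (path_graph 4) (complete n)) phi) => // x y E.
have {}E z : adj x z = adj y z by rewrite -!phi_adj E.
case: x y E => x [] y E.
- congr inl; apply: val_inj; have e k (k4 : k < 4) := E (inl (Ordinal k4)).
  by move: (e 0 isT) (e 1 isT) (e 2 isT) (e 3 isT); rewrite /= /path_adj /=;
   case: x y {E e} => [[|[|[|[|//]]]] ?] [[|[|[|[|//]]]] ?].
- by have := E (inr y); rewrite /= /complete_adj eqxx.
- by have := E (inr x); rewrite /= /complete_adj eqxx.
- by have := E (inr y); rewrite /= /complete_adj eqxx => /negbFE/eqP ->.
Qed.

Lemma cardsU_le A Q : #|A :|: Q| <= #|A| + #|Q|.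
Proof. by rewrite cardsU leq_subr. Qed.

Definition nbr u : {set G} := [set x | adj u x].

Lemma cliqueS K Q : Q \subset K -> clique K -> clique Q.
Proof.
by move=> QK /cliqueP cK; apply/cliqueP => u v uQ vQ; apply: cK; apply: (subsetP QK).
Qed.

Lemma cliqueU1 K u : clique K -> {in K, forall k, adj u k} -> clique (u |: K).
Proof.
move=> /cliqueP cK uK; apply/cliqueP => x y; rewrite !inE.
case/orP=> [/eqP->|xK] /orP[/eqP->|yK] ne.
- by rewrite eqxx in ne.
- exact: uK.
- by rewrite adj_sym uK.
- exact: cK.
Qed.

(** * Colouring from the non-neighbours in a clique *)

Section MissingSets.
Variables (n : nat) (K : {set G}).
Hypotheses (G2 : two_K2_free) (G4 : P4_join_free n).
Hypotheses (cK : clique K) (w_big : 4 * n + 4 <= #|K|).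

Definition miss u : {set G} := [set k in K | ~~ adj u k].

Lemma missP u k : k \in K -> (k \in miss u) = ~~ adj u k.
Proof. by rewrite inE => ->. Qed.

Lemma miss_sub u : miss u \subset K.
Proof. by apply/subsetP => k; rewrite inE => /andP[]. Qed.

Lemma miss_in u k : k \in miss u -> k \in K /\ ~~ adj u k.
Proof. by rewrite inE => /andP[]. Qed.

(** Two common vertices [i] and [j] would form a 2K_2 with [u] and [v]. *)
Lemma miss_adj u v i j : adj u v -> i \in miss u -> i \in miss v ->
  j \in miss u -> j \in miss v -> i = j.
Proof.
move=> uv /miss_in[iK ui] /miss_in[_ vi] /miss_in[jK uj] /miss_in[_ vj].
apply/eqP/negPn/negP => ij; have := G2 uv (cliqueP _ cK _ _ iK jK ij).
by rewrite (negbTE ui) (negbTE vi) (negbTE uj) (negbTE vj).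
Qed.

(** The vertices of [K] outside [M] form a clique joined to the P_4, so there are
    fewer than [n] of them. *)
Lemma P4_miss a b c d (M : {set G}) : induced_P4 a b c d ->
  [&& miss a \subset M, miss b \subset M, miss c \subset M & miss d \subset M] ->
  #|K| < #|M| + n.
Proof.
move=> P4 /and4P[aM bM cM dM].
have : #|K :\: M| < n.
  apply: G4 P4 (cliqueS (subsetDl _ _) cK) _ => x; rewrite inE => /andP[xM xK].
  apply/and4P; split; apply: contraR xM; rewrite -missP //.
  - exact: (subsetP aM).
  - exact: (subsetP bM).
  - exact: (subsetP cM).
  - exact: (subsetP dM).
have := cardsID M K; have := subset_leq_card (subsetIr K M); lia.
Qed.

Lemma miss_clique k : k \in K -> miss k = [set k].
Proof.
move=> kK; apply/setP => j; rewrite !inE; have [->|jk] := eqVneq j k.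
  by rewrite kK adj_irr.
by apply/negbTE; rewrite negb_and negbK; case jK: (j \in K) => //=; apply: (cliqueP _ cK); rewrite // eq_sym.
Qed.

(** The vertices [u], [j], [i], [v], in this order, induce a P_4. *)
Lemma miss_incomparable u v i j : ~~ adj u v -> i \in miss u -> i \notin miss v ->
  j \in miss v -> j \notin miss u -> #|K| < #|miss u :|: miss v| + n.
Proof.
move=> uv iu iv jv ju; have [iK ui] := miss_in iu; have [jK vj] := miss_in jv.
have ij : i != j by apply: contraNneq iv => ->.
rewrite missP // negbK in iv; rewrite missP // negbK in ju.
apply: (@P4_miss u j i v); last first.
  by rewrite subsetUl subsetUr (miss_clique iK) (miss_clique jK) !sub1set !inE iK jK ui vj ?orbT.
rewrite /induced_P4 ju uv ui (cliqueP _ cK) //= 1?eq_sym //.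
by rewrite adj_sym iv adj_sym vj.
Qed.

Section Optimal.
Hypothesis (K_max : forall K', clique K' -> #|K'| <= #|K|).
Hypothesis (K_opt : forall K', clique K' -> #|K'| = #|K| ->
  \sum_(k in K') #|nbr k| <= \sum_(k in K) #|nbr k|).

Lemma miss_neq0 u : exists k, k \in miss u.
Proof.
apply/set0Pn/eqP => mu; have uK : u \notin K.
  by apply/negP => uK; have := miss_clique uK; rewrite mu => /setP/(_ u); rewrite !inE eqxx.
have /K_max : clique (u |: K).
  apply: cliqueU1 => // k kK; apply/negPn/negP => uk.
  by have := missP u kK; rewrite mu inE uk.
by rewrite cardsU1 uK ltnn.
Qed.

(** The exchange behind the two uses of the choice of [K]: [u] can take the place of [k]. *)
Lemma miss1_swap u k : miss u = [set k] -> clique (u |: (K :\ k)) /\ #|u |: (K :\ k)| = #|K|.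
Proof.
move=> mu; have kK : k \in K by apply: (subsetP (miss_sub u)); rewrite mu set11.
have uK : u \notin K :\ k.
  rewrite !inE; apply/negP => /andP[uk uK]; move: mu; rewrite miss_clique // => /set1_inj uk'.
  by rewrite uk' eqxx in uk.
split; last by rewrite cardsU1 uK (cardsD1 k K) kK.
apply: cliqueU1; first exact: cliqueS (subsetDl _ _) cK.
move=> j; rewrite !inE => /andP[jk jK]; apply/negPn/negP; rewrite -missP // mu inE.
exact/negP.
Qed.

Lemma miss1_adj u v k : adj u v -> miss u = [set k] -> miss v = [set k] -> False.
Proof.
move=> uv mu mv; have [cu wu] := miss1_swap mu.
have kK : k \in K by apply: (subsetP (miss_sub u)); rewrite mu set11.
have cv : clique (v |: (u |: (K :\ k))).
  apply: cliqueU1 => // j; rewrite !inE => /orP[/eqP->|/andP[jk jK]]; first by rewrite adj_sym.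
  by apply/negPn/negP; rewrite -missP // mv inE; apply/negP.
have vK : v \notin u |: (K :\ k).
  rewrite !inE negb_or negb_and; apply/andP; split.
    by apply: contraTneq uv => ->; rewrite adj_irr.
  rewrite negbK; case vK: (v \in K); rewrite ?orbT // orbF.
  by move: mv; rewrite miss_clique // => /set1_inj ->.
by have := K_max cv; rewrite cardsU1 vK wu ltnn.
Qed.

Lemma miss1_degree u k : miss u = [set k] -> #|nbr u| <= #|nbr k|.
Proof.
move=> mu; have [cu wu] := miss1_swap mu.
have kK : k \in K by apply: (subsetP (miss_sub u)); rewrite mu set11.
have [uK|uK] := boolP (u \in K).
  by move: mu; rewrite miss_clique // => /set1_inj ->.
have := K_opt cu wu; rewrite big_setU1 ?inE ?(negbTE uK) ?andbF //=.
by rewrite (big_setD1 k kK) /= leq_add2r.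
Qed.

(** One of the two vertices, say [u], misses some [j] other than [k], as otherwise both
    could replace [k] in the clique. Then [u], [v], [j], [k] induce a P_4. *)
Lemma miss_meet u v k : adj u v -> k \in miss u -> k \in miss v ->
  #|K| < #|miss u :|: miss v| + n.
Proof.
have half x y j : adj x y -> k \in miss x -> k \in miss y -> j \in miss x -> j != k ->
    #|K| < #|miss x :|: miss y| + n.
  move=> xy kx ky jx jk; have [jK xj] := miss_in jx; have [kK yk] := miss_in ky.
  have [_ xk] := miss_in kx.
  have jy : j \notin miss y by apply: contra jk => jy; apply/eqP; apply: miss_adj xy _ _ _ _.
  rewrite missP // negbK in jy.
  apply: (@P4_miss x y j k).
    by rewrite /induced_P4 xy jy xj xk yk (cliqueP _ cK).
  by rewrite subsetUl subsetUr (miss_clique jK) (miss_clique kK) !sub1set !inE jK kK xj xk ?orbT.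
move=> uv ku kv.
have [j /andP[ju jk]|u1] := pickP [pred j | (j \in miss u) && (j != k)]; first exact: half ju jk.
have [j /andP[jv jk]|v1] := pickP [pred j | (j \in miss v) && (j != k)].
  by rewrite setUC; apply: half jv jk; rewrite // adj_sym.
have single (m : {set G}) : k \in m -> [pred j | (j \in m) && (j != k)] =1 pred0 -> m = [set k].
  move=> km m0; apply/setP => j; rewrite inE; apply/idP/eqP => [jm|->//].
  by have := m0 j; rewrite /= jm => /negbFE/eqP.
by case: (miss1_adj uv (single _ ku u1) (single _ kv v1)).
Qed.

(** Otherwise every [k] in [miss v] is missed by a neighbour [U k] of [v]. The sets
    [M k] of the other vertices that [U k] misses lie in the set [R] of clique vertices
    adjacent to [v], are pairwise disjoint, and each contains all but fewer than [n]
    elements of [R]. Since [K] and [miss v] are large, this is only possible if [R] is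
    small, and then some [M k] is empty. Now [U k] could replace [k] in [K], so its degree
    is not larger, and some [z] is adjacent to [k] but not to [U k]. By
    [miss_incomparable], [z] misses almost all of [K], as [v] does. So [v] and [z] are not
    adjacent, and the edges joining [v] to [U k] and [k] to [z] form a 2K_2. *)
Lemma private_miss v : n + 2 <= #|miss v| ->
  exists2 k, k \in miss v & forall u, adj u v -> k \notin miss u.
Proof.
move=> v_big; suff /exists_inP[k kv /forallP kP] :
    [exists k in miss v, [forall u, adj u v ==> (k \notin miss u)]].
  by exists k => // u uv; have /implyP/(_ uv) := kP u.
apply: contraT => /exists_inPn sat.
pose U k := odflt v [pick u | adj u v && (k \in miss u)].
have UP k : k \in miss v -> adj (U k) v /\ k \in miss (U k).
  move=> kv; rewrite /U; case: pickP => [u /andP[] //|none].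
  have := sat k kv; rewrite negb_forall => /existsP[u]; rewrite negb_imply negbK => uP.
  by have := none u; rewrite uP.
pose M k := miss (U k) :\: miss v; pose R := K :\: miss v.
have RE : #|R| + #|miss v| = #|K|.
  by rewrite addnC /R cardsD (setIidPr (miss_sub v)) subnKC // subset_leq_card // miss_sub.
have MR k : M k \subset R by apply: setSD; apply: miss_sub.
have UE k : k \in miss v -> miss (U k) = k |: M k.
  move=> kv; have [Ukv kU] := UP k kv; apply/setP => x; rewrite in_setU1 in_setD.
  apply/idP/orP => [xU|[/eqP->|/andP[_]]] //.
  case xv: (x \in miss v); last by right.
  by left; apply/eqP; apply: (miss_adj Ukv).
have M_big k : k \in miss v -> #|K| < #|miss v| + #|M k| + n.
  move=> kv; have [Ukv kU] := UP k kv; have := miss_meet Ukv kU kv.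
  have -> : miss (U k) :|: miss v = M k :|: miss v.
    have kv' : [set k] \subset miss v by rewrite sub1set.
    by rewrite UE // setUAC (setUidPr kv') setUC.
  have := cardsU_le (M k) (miss v); lia.
have M_disj k j : k \in miss v -> j \in miss v -> k != j -> [disjoint M k & M j].
  move=> kv jv kj; have [Ukv kU] := UP k kv; have [Ujv jU] := UP j jv.
  have small : #|miss (U k) :|: miss (U j)| + n <= #|K|.
    apply: (@leq_trans (#|[set k; j] :|: R| + n)).
      rewrite leq_add2r subset_leq_card // !UE // !subUset !sub1set !inE !eqxx ?orbT /=.
      by rewrite !(subset_trans (MR _) (subsetUr _ _)).
    have := cardsU_le [set k; j] R; rewrite cards2 kj; move: RE v_big w_big; clear; lia.
  rewrite -setI_eq0; apply/negPn/negP => /set0Pn[x].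
  rewrite in_setI !in_setD => /andP[/andP[_ xk] /andP[_ xj]].
  have jUk : j \notin miss (U k).
    by apply: contra kj => jk; apply/eqP; apply: (miss_adj Ukv).
  have kUj : k \notin miss (U j).
    by apply: contra kj => jk; apply/eqP; apply: (miss_adj Ujv).
  case Ukj: (adj (U k) (U j)).
    by have := miss_meet Ukj xk xj; rewrite ltnNge small.
  by have := miss_incomparable (negbT Ukj) kU kUj jU jUk; rewrite ltnNge small.
(* If no [M k] were empty, [miss v] would inject into [R], so [R] would contain at least
   half of [K]; but then two of the sets [M k] do not fit into it. *)
have [k kv Mk0] : exists2 k, k \in miss v & M k = set0.
  suff /exists_inP[i iv /eqP Mi0] : [exists k in miss v, M k == set0] by exists i.
  apply: contraT => /exists_inPn Mn0.
  pose g k := odflt v [pick x in M k].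
  have gM k : k \in miss v -> g k \in M k.
    by move=> kv; rewrite /g; case: pickP => //= none; case/set0Pn: (Mn0 k kv) => x; rewrite none.
  have g_inj : {in miss v &, injective g}.
    move=> k j kv jv gkj; apply/eqP/negPn/negP => kj.
    by have /disjointFr/(_ (gM k kv)) := M_disj k j kv jv kj; rewrite gkj gM.
  have vR : #|miss v| <= #|R|.
    rewrite -(card_in_imset g_inj) subset_leq_card //.
    by apply/subsetP => x /imsetP[k kv ->]; apply: (subsetP (MR k)); apply: gM.
  have [k [j [kv jv kj]]] : exists k j, [/\ k \in miss v, j \in miss v & k != j].
    by apply/card_gt1P; lia.
  have : #|M k :|: M j| <= #|R| by rewrite subset_leq_card // subUset !MR.
  have := M_disj k j kv jv kj; rewrite -setI_eq0 => /eqP dkj.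
  rewrite cardsU dkj cards0 subn0; have := M_big k kv; have := M_big j jv; lia.
have [uv _] := UP k kv; set u := U k in uv.
have uE : miss u = [set k] by rewrite UE // Mk0 setU0.
have v_huge : #|K| < #|miss v| + n by have := M_big k kv; rewrite Mk0 cards0 addn0.
have [kK vk] := miss_in kv.
have [z zk zu] : exists2 z, z \in nbr k & z \notin nbr u.
  apply/subsetPn/negP => sub; have := miss1_degree uE; rewrite leqNgt => /negP; apply.
  apply: proper_card; apply/properP; split=> //; exists v; rewrite !inE //.
  by rewrite adj_sym.
rewrite !inE in zk zu; have [j jz] := miss_neq0 z.
have kz : k \notin miss z by rewrite missP // negbK adj_sym.
have zu' : ~~ adj z u by rewrite adj_sym.
have z_huge : #|K| < #|[set k] :|: miss z| + n.
  rewrite setUC -uE; apply: (miss_incomparable zu' jz _ _ kz); last by rewrite uE set11.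
  by rewrite uE inE; apply: contraNneq kz => <-.
have vz : ~~ adj v z.
  apply/negP => vz; have : 1 < #|miss v :&: miss z|.
    have := cardsU_le [set k] (miss z); rewrite cards1.
    have := cardsUI (miss v) (miss z); have : #|miss v :|: miss z| <= #|K|.
      by rewrite subset_leq_card // subUset !miss_sub.
    move: w_big v_huge z_huge; clear; lia.
  case/card_gt1P => x [y []]; rewrite !in_setI => /andP[xv xz] /andP[yv yz] /eqP; apply.
  exact: miss_adj vz _ _ _ _.
have := G2 uv zk; have [_ uk] : k \in K /\ ~~ adj u k by apply: miss_in; rewrite uE inE.
by rewrite (negbTE uk) (negbTE zu) (negbTE vk) (negbTE vz).
Qed.

(** A vertex whose list [miss v] has at least [n + 2] elements gets a private colour. Two
    adjacent vertices that share a colour therefore both have shorter lists, which are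
    too short to nearly cover [K] as [miss_meet] demands. *)
Lemma colorable_clique : colorable G #|K|.
Proof.
pose good v k := (k \in miss v) && [forall u, adj u v ==> (k \notin miss u)].
pose f v := if [pick k | good v k] is Some k then k else odflt v [pick k in miss v].
have fP v : f v \in miss v.
  rewrite /f; case: pickP => [k /andP[] //|_]; case: pickP => //= none.
  by have [k] := miss_neq0 v; rewrite none.
have f_proper u v : adj u v -> f u != f v.
  move=> uv; apply/eqP => fuv; have fv := fP v; have fu := fP u.
  have small x y : adj x y -> f x = f y -> #|miss x| < n + 2.
    move=> xy fxy; rewrite ltnNge; apply/negP => /private_miss[k kx kP].
    have fx := fP x; have fy := fP y.
    move: fxy fx; rewrite {1 2}/f; case: pickP => [j /andP[_ /forallP/(_ y)]|/(_ k)].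
      by rewrite adj_sym xy /= => jy jE; rewrite jE fy in jy.
    rewrite /good kx /= => /negbT; rewrite negb_forall => /existsP[z]; rewrite negb_imply.
    by case/andP=> /kP ->.
  have su := small u v uv fuv; have sv : #|miss v| < n + 2.
    by apply: (small v u) => //; rewrite adj_sym.
  rewrite fuv in fu; have := miss_meet uv fu fv; have := cardsU_le (miss u) (miss v); lia.
have /card_gt0P[k0 k0K] : 0 < #|K| by lia.
apply/existsP; exists [ffun v => enum_rank_in k0K (f v)].
apply/forallP => u; apply/forallP => v; apply/implyP => uv; rewrite !ffunE.
apply: contra (f_proper u v uv) => /eqP /enum_rank_in_inj E.
by apply/eqP; apply: E; apply: (subsetP (miss_sub _)).
Qed.

End Optimal.
End MissingSets.

Lemma colorable_leq_clique k K : colorable G k -> clique K -> #|K| <= k.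
Proof.
case/existsP => c /forallP cP /cliqueP cK.
have c_inj : {in K &, injective c}.
  move=> u v uK vK cuv; apply/eqP/negPn/negP => uv.
  by have /forallP/(_ v)/implyP/(_ (cK u v uK vK uv)) := cP u; rewrite cuv eqxx.
by rewrite -(card_in_imset c_inj) -[k in leqRHS]card_ord max_card.
Qed.

Lemma colorableE k : colorable G k = (chromatic_number G <= k).
Proof.
rewrite /chromatic_number; case: ex_minnP => m /existsP[c /forallP cP] m_min.
apply/idP/idP => [/m_min //|mk]; apply/existsP; exists [ffun x => widen_ord mk (c x)].
apply/forallP => x; apply/forallP => y; apply/implyP => xy; rewrite !ffunE.
by have /forallP/(_ y)/implyP/(_ xy) := cP x.
Qed.

Lemma chromatic_number_clique n Q : two_K2_free -> P4_join_free n ->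
  clique Q -> 4 * n + 4 <= #|Q| ->
  exists K, [/\ clique K, forall K', clique K' -> #|K'| <= #|K| & chromatic_number G = #|K|].
Proof.
move=> G2 G4 cQ Q_big.
case: (@arg_maxnP {set G} Q clique (fun K => #|K|) cQ) => K0 cK0 K0_max.
pose P K := clique K && (#|K| == #|K0|).
have PK0 : P K0 by rewrite /P cK0 /=.
case: (@arg_maxnP {set G} K0 P (fun K => \sum_(k in K) #|nbr k|) PK0) => K /andP[cK /eqP KE] K_opt.
have K_max K' : clique K' -> #|K'| <= #|K| by rewrite KE; apply: K0_max.
exists K; split=> //; apply/eqP; rewrite eqn_leq -colorableE; apply/andP; split.
  apply: (colorable_clique G2 G4 cK) => //; first exact: leq_trans Q_big (K_max Q cQ).
  by move=> K' cK' K'E; apply: K_opt; rewrite /P cK' K'E KE /=.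
by apply: colorable_leq_clique cK; rewrite colorableE.
Qed.

(** * Counting a maximum clique *)

(** If [q] is a long enough clique, then in the graph induced by the vertices that satisfy
    [core], non-adjacent vertices have nested neighbourhoods. This graph is the complement of the comparability graph of a rooted
    forest: [top] describes the leaves up to twins, [top_rep] picks in each class of twins
    the first one in the enumeration of the vertices, and there are as many classes as
    vertices in a maximum clique. *)
Section Core.
Variables (m : nat) (q : 'I_m -> G).

Definition clique_tuple : bool := [forall i, forall j, (i != j) ==> adj (q i) (q j)].

Definition core u : bool := \sum_(i < m) ~~ adj u (q i) <= 1.

Definition below u v : bool := [forall z, core z ==> (adj u z ==> adj v z)].

Definition top u : bool :=
  core u && [forall v, core v ==> (~~ adj u v ==> below v u)].

Definition top_rep u : bool :=
  top u && [forall v, top v ==> ((enum_rank v < enum_rank u) ==> adj u v)].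

Lemma belowP u v : reflect (forall z, core z -> adj u z -> adj v z) (below u v).
Proof.
apply: (iffP forallP) => [H z cz uz|H z]; first by have /implyP/(_ cz)/implyP := H z; apply.
by apply/implyP => cz; apply/implyP; apply: H.
Qed.

Lemma clique_tuple_adj i j : clique_tuple -> i != j -> adj (q i) (q j).
Proof. by move=> /forallP/(_ i)/forallP/(_ j)/implyP. Qed.

Lemma clique_tuple_inj : clique_tuple -> injective q.
Proof.
move=> cq i j qij; apply/eqP/negPn/negP => /(clique_tuple_adj cq).
by rewrite qij adj_irr.
Qed.

Lemma clique_tuple_imset (J : {set 'I_m}) : clique_tuple -> clique (q @: J).
Proof.
move=> cq; apply/cliqueP => x y /imsetP[i _ ->] /imsetP[j _ ->] ij.
by apply: clique_tuple_adj => //; apply: contraNneq ij => ->.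
Qed.

Lemma clique_top_rep : clique [set u | top_rep u].
Proof.
apply/cliqueP => u v; rewrite !inE => /andP[tu /forallP uP] /andP[tv /forallP vP] uv.
have := uP v; have := vP u; rewrite tu tv /= adj_sym.
case: (ltngtP (enum_rank u) (enum_rank v)) => //= /val_inj /enum_rank_inj E.
by rewrite E eqxx in uv.
Qed.

(** Each vertex of such a P_4 has at most one non-neighbour in the tuple, so at least [n] of the
    [m] vertices of the tuple are adjacent to all four. *)
Lemma core_P4_free n a b c d : P4_join_free n -> n + 4 <= m -> clique_tuple ->
  core a -> core b -> core c -> core d -> ~~ induced_P4 a b c d.
Proof.
move=> G4 m_big cq ca cb cc cd; apply/negP => P4.
pose J := [set i | [&& adj a (q i), adj b (q i), adj c (q i) & adj d (q i)]].
have : #|q @: J| < n.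
  apply: G4 P4 (clique_tuple_imset _ cq) _ => x /imsetP[i].
  by rewrite inE => iJ ->.
rewrite card_imset; last exact: clique_tuple_inj.
suff : #|~: J| <= 4.
  by move=> C4 Jn; have := cardsC J; rewrite card_ord => JE; lia.
rewrite -sum1_card; apply: (@leq_trans (\sum_(i < m) (~~ adj a (q i) + ~~ adj b (q i)
   + ~~ adj c (q i) + ~~ adj d (q i)))).
  rewrite big_mkcond /=; apply: leq_sum => i _; rewrite !inE.
  by case: (adj a _); case: (adj b _); case: (adj c _); case: (adj d _).
by rewrite !big_split /= -[4]/(1 + 1 + 1 + 1) !leq_add.
Qed.

(** Among the vertices that are not adjacent to a given [k] in [K] and whose neighbourhood
    contains that of [k], the first one with the largest neighbourhood is a [top_rep]. This
    neighbourhood contains [K] minus [k], so different [k] lead to different vertices. *)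
Lemma leq_card_top_rep n K : two_K2_free -> P4_join_free n -> n + 4 <= m -> clique_tuple ->
  clique K -> (forall i, q i \in K) -> #|K| <= #|[set u | top_rep u]|.
Proof.
move=> G2 G4 m_big cq cK qK.
have q_inj := clique_tuple_inj cq.
have K_core k : k \in K -> core k.
  move=> kK; rewrite /core; have [i /eqP qi|none] := pickP (fun i => q i == k).
    rewrite (bigD1 i) //= big1 ?addn0 ?leq_b1 // => j ji.
    apply/eqP; rewrite eqb0 negbK; apply: (cliqueP _ cK) => //.
    by apply: contraNneq ji => kj; apply/eqP/q_inj; rewrite qi.
  rewrite big1 // => j _; apply/eqP; rewrite eqb0 negbK; apply: (cliqueP _ cK) => //.
  by rewrite eq_sym; apply: negbT (none j).
have nested u v : core u -> core v -> ~~ adj u v -> below u v || below v u.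
  move=> cu cv uv; apply/orP; have [|/forallPn[x]] := boolP (below u v); first by left.
  rewrite !negb_imply => /and3P[cx ux vx].
  have [|/forallPn[y]] := boolP (below v u); first by right.
  rewrite !negb_imply => /and3P[cy vy uy].
  have := G2 u x v y ux vy; rewrite (negbTE uv) (negbTE uy) adj_sym (negbTE vx) /= => xy.
  have /negP[] := core_P4_free G4 m_big cq cu cx cy cv.
  by rewrite /induced_P4 ux xy adj_sym vy uv uy adj_sym vx.
pose deg u := #|[set z | core z && adj u z]|.
(* Compares first by [deg], then, in reverse, by the position in the enumeration. *)
pose F u := deg u * #|G| + (#|G| - enum_rank u).
have rank_lt u : enum_rank u < #|G| by apply: ltn_ord.
have below_deg u v : below u v -> deg u <= deg v.
  move=> /belowP uv; apply: subset_leq_card; apply/subsetP => z; rewrite !inE.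
  by case/andP => cz /(uv z cz) ->; rewrite cz.
have F_deg u v : deg u < deg v -> F u < F v.
  move=> uv; have : (deg u).+1 * #|G| <= deg v * #|G| by rewrite leq_mul2r uv orbT.
  have := rank_lt v; rewrite /F mulSn; lia.
have F_rank u v : deg v <= deg u -> enum_rank u < enum_rank v -> F v < F u.
  move=> uv; have : deg v * #|G| <= deg u * #|G| by rewrite leq_mul2r uv orbT.
  have := rank_lt v; rewrite /F; lia.
have repP k : k \in K -> exists u, [&& top_rep u, below k u & ~~ adj u k].
  move=> kK; have ck := K_core k kK.
  pose P u := [&& core u, ~~ adj u k & below k u].
  have Pk : P k by rewrite /P ck adj_irr /=; apply/belowP.
  case: (@arg_maxnP G k P F Pk) => r /and3P[cr rk kr] r_max.
  have step v : core v -> ~~ adj r v -> below r v -> P v.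
    move=> cv rv rv'; rewrite /P cv /=; apply/andP; split.
      apply: contra rv => vk; by move/belowP: kr; apply => //; rewrite adj_sym.
    by apply/belowP => z cz kz; move/belowP: rv'; apply=> //; move/belowP: kr; apply.
  have r_top : top r.
    rewrite /top cr; apply/forallP => v; apply/implyP => cv; apply/implyP => rv.
    have [//|vr] := boolP (below v r).
    have rv' : below r v by have := nested _ _ cr cv rv; rewrite (negbTE vr) orbF.
    have : F v <= F r := r_max v (step v cv rv rv'); rewrite leqNgt => /negP[]; apply: F_deg.
    apply: proper_card; apply/properP; split.
      by apply/subsetP => z; rewrite !inE => /andP[cz] /(belowP _ _ rv' z cz) ->; rewrite cz.
    move: vr; rewrite negb_forall => /existsP[z]; rewrite !negb_imply => /and3P[cz vz rz].
    by exists z; rewrite !inE cz.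
  exists r; rewrite kr rk /top_rep r_top !andbT /=; apply/forallP => v; apply/implyP => tv.
  apply/implyP => lt_vr; apply/negPn/negP => rv.
  have /andP[cv /forallP/(_ r)] := tv; rewrite cr adj_sym rv /= => rv'.
  have : F v <= F r := r_max v (step v cv rv rv'); rewrite leqNgt => /negP[]; apply: F_rank lt_vr.
  exact: below_deg.
pose g k := odflt k [pick u | [&& top_rep u, below k u & ~~ adj u k]].
have gP k : k \in K -> [&& top_rep (g k), below k (g k) & ~~ adj (g k) k].
  by move=> /repP[u uP]; rewrite /g; case: pickP => //= none; rewrite none in uP.
have g_inj : {in K &, injective g}.
  move=> k j kK jK gkj; apply/eqP/negPn/negP => kj.
  have /and3P[_ /belowP kg _] := gP k kK; have /and3P[_ _ /negP[]] := gP j jK.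
  by rewrite -gkj; apply: kg; [apply: K_core | apply: (cliqueP _ cK)].
rewrite -(card_in_imset g_inj); apply: subset_leq_card; apply/subsetP => u /imsetP[k kK ->].
by rewrite inE; have /and3P[] := gP k kK.
Qed.

End Core.

Lemma clique_tuple_in m K : clique K -> m <= #|K| ->
  exists2 q : {ffun 'I_m -> G}, clique_tuple q & forall i, q i \in K.
Proof.
move=> cK mK; pose q : {ffun 'I_m -> G} := [ffun i => enum_val (widen_ord mK i)].
have qK i : q i \in K by rewrite ffunE enum_valP.
exists q => //; apply/forallP => i; apply/forallP => j; apply/implyP => ij.
apply: (cliqueP _ cK); rewrite ?qK // !ffunE.
by apply: contra ij => /eqP/enum_val_inj/(congr1 val)/= ij; apply/eqP/val_inj.
Qed.

(** * Few colours *)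

(** For an edge [a b], the neighbourhoods of [a] and of [b] have smaller cliques, and the
    vertices outside both are independent, for lack of a 2K_2. So three times as many colours
    suffice for one more vertex in the cliques. *)
Lemma colorable_bounded_clique m : two_K2_free -> (forall K, clique K -> #|K| <= m) ->
  colorable G (3 ^ m).
Proof.
move=> G2; suff main : forall A : {set G}, (forall K, K \subset A -> clique K -> #|K| <= m) ->
    exists c : G -> nat, (forall u, c u < 3 ^ m) /\ {in A &, forall u v, adj u v -> c u != c v}.
  move=> K_small; have [|c [c_lt cP]] := main setT; first by move=> K _; apply: K_small.
  apply/existsP; exists [ffun u => Ordinal (c_lt u)]; apply/forallP => u; apply/forallP => v.
  by apply/implyP => uv; rewrite !ffunE -val_eqE /= cP.
elim: m => [|m IH] A A_small.
  exists (fun=> 0); split=> // u v uA; have := A_small [set u].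
  rewrite sub1set uA cards1 => /(_ isT) H; suff /H : clique [set u] by [].
  by apply/cliqueP => x y; rewrite !inE => /eqP-> /eqP->; rewrite eqxx.
have [[a b]|none] := pickP (fun e : G * G => [&& e.1 \in A, e.2 \in A & adj e.1 e.2]); last first.
  exists (fun=> 0); split=> [u|u v uA vA uv]; first by rewrite expn_gt0.
  by have := none (u, v); rewrite /= uA vA uv.
case/and3P=> /= aA bA ab.
have part d : d \in A -> exists c : G -> nat, (forall u, c u < 3 ^ m) /\
    {in A :&: nbr d &, forall u v, adj u v -> c u != c v}.
  move=> dA; apply: IH => K; rewrite subsetI => /andP[KA /subsetP Kd] cK.
  have dK k : k \in K -> adj d k by move=> /Kd; rewrite inE.
  have := A_small (d |: K); rewrite cardsU1 subUset sub1set dA KA cliqueU1 //.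
  have -> : d \notin K by apply/negP => /dK; rewrite adj_irr.
  by move/(_ isT isT).
have [ca [ca_lt caP]] := part a aA; have [cb [cb_lt cbP]] := part b bA.
exists (fun u => if adj a u then ca u else if adj b u then 3 ^ m + cb u else 3 ^ m + 3 ^ m).
have pos : 0 < 3 ^ m by rewrite expn_gt0.
split=> [u|u v uA vA uv].
  by have := ca_lt u; have := cb_lt u; rewrite expnS; case: ifP => _; [|case: ifP => _]; lia.
have := ca_lt u; have := cb_lt u; have := ca_lt v; have := cb_lt v.
case au: (adj a u); case av: (adj a v).
- by move=> _ _ _ _; apply: caP; rewrite ?inE ?uA ?vA.
- by move: pos; clear; case: (adj b v) => *; lia.
- by move: pos; clear; case: (adj b u) => *; lia.
case bu: (adj b u); case bv: (adj b v).
- by move=> _ _ _ _; rewrite eqn_add2l; apply: cbP; rewrite ?inE ?uA ?vA.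
- by clear; lia.
- by clear; lia.
by have := G2 _ _ _ _ ab uv; rewrite au av bu bv.
Qed.

(** The vertex [x i j], for [i < j], is meant to have colour [i] and to be adjacent to all
    vertices of colour [j]. Then [in_class i] is exactly the set of vertices of colour [i]. *)
Section ClassTest.
Variables (k : nat) (x : 'I_k -> 'I_k -> G).
Implicit Types i j : 'I_k.

Definition in_class i u : bool :=
  [forall j : 'I_k, (j < i) ==> adj u (x j i)] && [forall j : 'I_k, (i < j) ==> ~~ adj u (x i j)].

Definition classes_color : bool :=
  [forall u, [exists i : 'I_k, in_class i u]] &&
  [forall u, forall v, adj u v ==> [forall i : 'I_k, ~~ (in_class i u && in_class i v)]].

Lemma classes_color_colorable : classes_color -> colorable G k.
Proof.
case/andP=> /forallP cover /forallP proper.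
have /fin_all_exists[c cP] : forall u, exists i, in_class i u.
  by move=> u; apply/existsP; apply: cover.
apply/existsP; exists [ffun u => c u]; apply/forallP => u; apply/forallP => v.
apply/implyP => uv; rewrite !ffunE; apply/eqP => cuv.
have /forallP/(_ v)/implyP/(_ uv)/forallP/(_ (c u)) := proper u.
by rewrite cP cuv cP.
Qed.

End ClassTest.

(** Take a colouring with the least sum of colours. A vertex of colour [j] then has a
    neighbour of each colour [i < j]. The bipartite graph between two colours contains no 2K_2,
    so its neighbourhoods are nested, and a vertex of colour [i] with the most neighbours of
    colour [j] is adjacent to all of them. *)
Lemma colorable_classes k : two_K2_free -> 0 < #|G| -> colorable G k ->
  exists x : 'I_k -> 'I_k -> G, classes_color x.
Proof.
move=> G2 /card_gt0P[u0 _] /existsP[f0 f0P].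
pose P (f : {ffun G -> 'I_k}) := [forall x, forall y, adj x y ==> (f x != f y)].
case: (@arg_minnP _ f0 P (fun f => \sum_u f u) f0P) => f /forallP fP f_min.
have f_adj u v : adj u v -> f u != f v by have /forallP/(_ v)/implyP := fP u.
have grundy u (i : 'I_k) : i < f u -> exists2 v, f v = i & adj u v.
  move=> iu; suff /exists_inP[v /eqP] : [exists v in [pred v | f v == i], adj u v] by exists v.
  apply: contraT => /exists_inPn none; pose f' := [ffun v => if v == u then i else f v].
  have Pf' : P f'.
    apply/forallP => v; apply/forallP => w; apply/implyP => vw; rewrite !ffunE.
    case: (eqVneq v u) (eqVneq w u) => [vu|vu] [wu|wu].
    - by rewrite vu wu adj_irr in vw.
    - by apply/negP => /eqP iw; have := none w; rewrite inE -iw eqxx -vu vw => /(_ isT).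
    - by apply/negP => /eqP iv; have := none v; rewrite inE -iv eqxx -wu adj_sym vw => /(_ isT).
    exact: f_adj.
  have := f_min f' Pf'; rewrite leqNgt => /negP[].
  rewrite (bigD1 u) //= [ltnRHS](bigD1 u) //= ffunE eqxx -addSn leq_add //.
  by apply: leq_sum => v /negbTE vu; rewrite ffunE vu.
(* The first conjunct matters when colour [j] is not used. *)
have xP (i j : 'I_k) : exists v, (forall w, f w = i -> f v = i) /\
    (forall u, f u = j -> i < j -> adj u v).
  have [v0 /eqP v0i|none] := pickP (fun v => f v == i); last first.
    exists u0; split=> [w wi|u uj ij]; first by have := none w; rewrite wi eqxx.
    by have [|v vi _] := grundy u i; [rewrite uj | have := none v; rewrite vi eqxx].
  pose N v := [set u | (f u == j) && adj v u].
  have v0P : f v0 == i by rewrite v0i.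
  case: (@arg_maxnP G v0 (fun v => f v == i) (fun v => #|N v|) v0P) => v /eqP vi v_max.
  exists v; split=> // u uj ij; apply: contraT => uv.
  have [|w wi uw] := grundy u i; first by rewrite uj.
  have [y] : exists2 y, y \in N v & y \notin N w.
    apply/subsetPn/negP => sub; have : #|N w| <= #|N v| by apply: v_max; rewrite wi.
    rewrite leqNgt => /negP[]; apply: proper_card; apply/properP; split=> //.
    by exists u; rewrite !inE uj eqxx //= adj_sym.
  rewrite !inE => /andP[/eqP yj vy]; rewrite yj eqxx /= => wy.
  have wu : adj w u by rewrite adj_sym.
  have := G2 v y w u vy wu; case vw: (adj v w); first by have := f_adj _ _ vw; rewrite vi wi eqxx.
  case yu: (adj y u); first by have := f_adj _ _ yu; rewrite yj uj eqxx.
  by rewrite adj_sym (negbTE uv) adj_sym (negbTE wy).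
have /fin_all_exists[x0 x0P] : forall ij : 'I_k * 'I_k, exists v,
    (forall w, f w = ij.1 -> f v = ij.1) /\ (forall u, f u = ij.2 -> ij.1 < ij.2 -> adj u v).
  by case=> i j; apply: xP.
pose x i j := x0 (i, j).
have x_color u (j : 'I_k) : f (x (f u) j) = f u by have [H _] := x0P (f u, j); apply: (H u).
have x_adj u (i : 'I_k) : i < f u -> adj u (x i (f u)).
  by have [_ H] := x0P (i, f u); apply: H.
have own u : in_class x (f u) u.
  apply/andP; split; apply/forallP => j; apply/implyP; first exact: x_adj.
  by move=> _; apply/negP => /f_adj; rewrite x_color eqxx.
have only u i : in_class x i u -> i = f u.
  case/andP=> /forallP lo /forallP hi; apply: val_inj; case: (ltngtP i (f u)) => // lt_i.
    by have /implyP/(_ lt_i) := hi (f u); rewrite x_adj.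
  by have /implyP/(_ lt_i)/f_adj := lo (f u); rewrite x_color eqxx.
exists x; apply/andP; split; apply/forallP => u; first by apply/existsP; exists (f u).
apply/forallP => v; apply/implyP => uv; apply/forallP => i; apply/negP => /andP[/only iu /only iv].
by have := f_adj u v uv; rewrite -iu -iv eqxx.
Qed.

Definition class_test (k : nat) : bool :=
  [exists x : {ffun 'I_#|{: 'I_k * 'I_k}| -> G}, classes_color (fun i j => x (enum_rank (i, j)))].

Lemma eq_classes_color k (x y : 'I_k -> 'I_k -> G) : (forall i j, x i j = y i j) ->
  classes_color x = classes_color y.
Proof.
move=> xy; have E i u : in_class x i u = in_class y i u.
  by congr andb; apply: eq_forallb => j; rewrite xy.
congr andb; first by apply: eq_forallb => u; apply: eq_existsb => i; apply: E.
by do 2!apply: eq_forallb => ?; congr (_ ==> _); apply: eq_forallb => i; rewrite !E.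
Qed.

Lemma class_testE k : two_K2_free -> 0 < #|G| -> class_test k = colorable G k.
Proof.
move=> G2 G0; apply/existsP/idP => [[x]|]; first exact: classes_color_colorable.
case/(colorable_classes G2 G0) => x xP.
exists [ffun i => x (enum_val i).1 (enum_val i).2].
by rewrite (@eq_classes_color _ _ x) // => i j; rewrite ffunE enum_rankK.
Qed.

End Graph.

(** * Compiling counting terms *)

(** Variables stand for vertices, numbered by their position in the enumeration of the graph,
    and [Read] looks up the adjacency matrix. [Fold] binds one more variable, which ranges
    over all vertices; it takes the maximum or, for [false], the sum. *)
Inductive term (I : Type) : Type :=
| Const of nat
| Var of I
| Add of term I & term I
| Sub of term I & term I
| Read of term I
| Fold of bool & term (option I).

Definition fold_op (mx : bool) : nat -> nat -> nat := if mx then maxn else addn.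

Definition extend (G I : Type) (x : G) (rho : I -> G) (i : option I) : G :=
  if i is Some j then rho j else x.

Fixpoint eval (G : sgraph) (I : Type) (e : term I) (rho : I -> G) : nat :=
  match e with
  | Const c => c
  | Var i => enum_rank (rho i)
  | Add e1 e2 => eval e1 rho + eval e2 rho
  | Sub e1 e2 => eval e1 rho - eval e2 rho
  | Read e1 => nth 0 (adjacency_matrix G) (eval e1 rho)
  | Fold mx e1 => foldl (fold_op mx) 0 [seq eval e1 (extend x rho) | x <- enum G]
  end.

(** Register 0 holds the number of vertices throughout. The loop accumulates its result in
    register [d] and keeps the bound variable in [d.+1]; [body] leaves its value in [d.+2].
    The maximum is computed as [a + (b - a)]. *)
Definition loop (mx : bool) (body : program) (d l : nat) : program :=
  [:: IConst d 0; IConst d.+1 0; IConst d.+2 1; IJump d.+2 (l + 4 + size body + 4)]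
  ++ body
  ++ [:: if mx then ISub d.+2 d.+2 d else IConst d.+3 0;
         IAdd d d d.+2; IConst d.+2 1; IAdd d.+1 d.+1 d.+2;
         ISub d.+2 0 d.+1; IJump d.+2 (l + 4)].

(** The code starts at line [l] and leaves its value in register [d]; the variable [i] is
    kept in register [v i], and the registers below [d] are preserved. *)
Fixpoint compile (I : Type) (e : term I) (v : I -> nat) (d l : nat) : program :=
  match e with
  | Const c => [:: IConst d c]
  | Var i => [:: IConst d 0; IAdd d d (v i)]
  | Add e1 e2 =>
      let p1 := compile e1 v d l in
      p1 ++ compile e2 v d.+1 (l + size p1) ++ [:: IAdd d d d.+1]
  | Sub e1 e2 =>
      let p1 := compile e1 v d l in
      p1 ++ compile e2 v d.+1 (l + size p1) ++ [:: ISub d d d.+1]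
  | Read e1 => compile e1 v d l ++ [:: IRead d d]
  | Fold mx e1 =>
      loop mx (compile e1 (extend d.+1 v) d.+2 (l + 4)) d l
  end.

(** Every loop runs over all vertices and there is no other branching, so the running time is
    the same for all graphs with [N] vertices. *)
Fixpoint time (I : Type) (e : term I) (N : nat) : nat :=
  match e with
  | Const _ => 1
  | Var _ => 2
  | Add e1 e2 | Sub e1 e2 => time e1 N + time e2 N + 1
  | Read e1 => time e1 N + 1
  | Fold _ e1 => 6 + N * (time e1 N + 6)
  end.

Definition code_at (p : program) (l : nat) (c : program) : Prop :=
  exists pre post, p = pre ++ c ++ post /\ size pre = l.

Lemma code_at_cat p l c1 c2 :
  code_at p l (c1 ++ c2) -> code_at p l c1 /\ code_at p (l + size c1) c2.
Proof.
move=> [pre [post [-> <-]]]; split; first by exists pre, (c2 ++ post); rewrite -!catA.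
by exists (pre ++ c1), post; rewrite size_cat -!catA.
Qed.

Lemma code_at_cons p l a c :
  code_at p l (a :: c) -> onth p l = Some a /\ code_at p l.+1 c.
Proof.
move=> [pre [post [-> <-]]]; split; first by rewrite onth_cat ltnn subnn.
by exists (rcons pre a), post; rewrite cat_rcons size_rcons.
Qed.

Lemma run_add p t1 t2 s : run p (t1 + t2) s = run p t2 (run p t1 s).
Proof. by rewrite /run addnC iterD. Qed.

Lemma run1 p t l r m a : onth p l = Some a ->
  run p t.+1 (Config l r m) = run p t (exec a (Config l r m)).
Proof. by rewrite /run iterSr /step /= => ->. Qed.

Lemma foldl_fold_op_rcons mx z s x :
  foldl (fold_op mx) z (rcons s x) = fold_op mx (foldl (fold_op mx) z s) x.
Proof. by rewrite -cats1 foldl_cat. Qed.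

Local Arguments run : simpl never.

Lemma loop_correct p mx body d l T F r m N :
  code_at p l (loop mx body d l) -> 0 < d -> r 0 = N ->
  (forall k r1, k < N -> (forall i, i < d -> r1 i = r i) -> r1 d.+1 = k ->
   exists r2, run p T (Config (l + 4) r1 m) = Config (l + 4 + size body) r2 m
     /\ r2 d.+2 = F k /\ forall i, i < d.+2 -> r2 i = r1 i) ->
  exists r', run p (6 + N * (T + 6)) (Config l r m) = Config (l + size (loop mx body d l)) r' m
    /\ r' d = foldl (fold_op mx) 0 (map F (iota 0 N)) /\ forall i, i < d -> r' i = r i.
Proof.
set test := l + 4 + size body + 4 => cat d0 r0 bodyP.
have := cat; rewrite /loop -/test => /code_at_cons[c1 /code_at_cons[c2 /code_at_cons[c3]]].
move=> /code_at_cons[c4 /code_at_cat[]]; have ->: l.+4 = l + 4 by lia.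
move=> cb /code_at_cons[k1 /code_at_cons[k2 /code_at_cons[k3 /code_at_cons[k4]]]].
move=> /code_at_cons[k5 /code_at_cons[k6 _]].
(* The registers when the loop test is reached with [k] in the bound variable. *)
pose inv k r' := [/\ r' d = foldl (fold_op mx) 0 (map F (iota 0 k)),
  r' d.+1 = k & forall i, i < d -> r' i = r i].
have testE : test = (l + 4 + size body).+4 by rewrite /test; lia.
have looping k r' : inv k r' -> k <= N ->
  exists r'', run p ((N - k) * (T + 6) + 2) (Config test r' m) = Config test.+2 r'' m
    /\ inv N r''.
  move En: (N - k) => n; elim: n k r' En => [|n IHn] k r' En [r'd r'd1 r'lt] kN.
    have {}kN: k = N by lia.
    rewrite mul0n add0n testE (run1 _ _ _ k5) /= (run1 _ _ _ k6) /= eqxx.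
    rewrite r'lt // r0 r'd1 kN subnn; eexists; split; first by [].
    split=> [||i id] /=.
    + by rewrite ltn_eqF // r'd kN.
    + by rewrite ltn_eqF // r'd1.
    + by rewrite ltn_eqF ?r'lt //; lia.
  have {}kN: k < N by lia.
  have ->: n.+1 * (T + 6) + 2 = 2 + (T + (4 + (n * (T + 6) + 2))) by lia.
  rewrite (run_add _ 2) (run_add _ T) (run_add _ 4) {1}testE (run1 _ _ _ k5) /= (run1 _ _ _ k6) /= eqxx r'lt // r0 r'd1.
  have -> : N - k != 0 by lia.
  set r1 := (r1 in Config _ r1 m).
  have r1E i : i < d.+2 -> r1 i = r' i by move=> id; rewrite /r1 /= ltn_eqF.
  have [||r2 [run_2 [r2d r2lt]]] := bodyP k r1 kN.
  + by move=> i id; rewrite r1E ?r'lt //; lia.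
  + by rewrite r1E.
  have r2d' : r2 d = r' d by rewrite r2lt ?r1E //; lia.
  have r2d1 : r2 d.+1 = k by rewrite r2lt ?r1E.
  have r2i i : i < d -> r2 i = r i by move=> id; rewrite r2lt ?r1E ?r'lt //; lia.
  have opE : r2 d + (if mx then r2 d.+2 - r2 d else r2 d.+2) = fold_op mx (r' d) (F k).
    by rewrite r2d' r2d; case: (mx) => //=; rewrite maxnE.
  have xE : map F (iota 0 k.+1) = rcons (map F (iota 0 k)) (F k).
    by rewrite -addn1 iotaD map_cat cats1.
  have [r3 [run_3 inv3]] : exists r3, run p 4 (Config (l + 4 + size body) r2 m)
      = Config test r3 m /\ inv k.+1 r3.
    rewrite /inv xE foldl_fold_op_rcons -r'd -opE testE.
    have [e1 e2 e3 e4] : [/\ d == d.+1 = false, d == d.+2 = false, d.+1 == d = false &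
      d.+1 == d.+2 = false] by split; lia.
    have [e5 e6 e7 e8] : [/\ d == d.+3 = false, d.+1 == d.+3 = false, d.+2 == d.+3 = false &
      d.+2 == d = false] by split; lia.
    have e i : i < d -> [/\ i == d = false, i == d.+1 = false, i == d.+2 = false &
      i == d.+3 = false] by move=> id; split; lia.
    case: (mx) k1 => k1; rewrite (run1 _ _ _ k1) /= (run1 _ _ _ k2) /=
      (run1 _ _ _ k3) /= (run1 _ _ _ k4) /=; eexists; (split; first by []);
      split=> [||i /[dup] id /e[i1 i2 i3 i4]] /=.
    all: rewrite ?eqxx ?e1 ?e2 ?e3 ?e4 ?e5 ?e6 ?e7 ?e8 ?i1 ?i2 ?i3 ?i4 ?eqxx
      ?r2d1 ?addn1 //; try exact: r2i.
  rewrite run_2 run_3; apply: (IHn k.+1) => //; lia.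
have [|//|r2 [run_2 [r2d r2d1 r2lt]]] := looping 0
  [eta [eta [eta r with d |-> 0] with d.+1 |-> 0] with d.+2 |-> 1].
  split=> [||i id] /=; rewrite ?eqxx //.
  + by rewrite !ltn_eqF.
  + by rewrite ltn_eqF.
  + by rewrite !ltn_eqF //; lia.
rewrite subn0 in run_2.
have ->: 6 + N * (T + 6) = 4 + (N * (T + 6) + 2) by lia.
rewrite run_add (run1 _ _ _ c1) /= (run1 _ _ _ c2) /= (run1 _ _ _ c3) /= (run1 _ _ _ c4) /= eqxx /=.
rewrite {2}/run /= run_2; exists r2; split; last by [].
by congr Config; rewrite /test /= size_cat /=; lia.
Qed.

Lemma compile_correct (G : sgraph) p (I : Type) (e : term I) (v : I -> nat) d l r
    (rho : I -> G) (m := nth 0 (adjacency_matrix G)) N :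
  #|G| = N ->
  code_at p l (compile e v d l) -> 0 < d -> r 0 = N ->
  (forall i, v i < d /\ r (v i) = enum_rank (rho i)) ->
  exists r', run p (time e N) (Config l r m) = Config (l + size (compile e v d l)) r' m
    /\ r' d = eval e rho /\ forall i, i < d -> r' i = r i.
Proof.
move=> cardG; elim: e v d l r rho => {I} [I c|I i|I e1 IH1 e2 IH2|I e1 IH1 e2 IH2|I e IH|I mx e IH]
  v d l r rho cat d0 r0 rv /=.
- have [c1 _] := code_at_cons cat.
  rewrite (run1 _ _ _ c1) /= addn1; eexists; split; first by [].
  by rewrite /= eqxx; split=> // i /ltn_eqF ->.
- have [vd rvi] := rv i.
  have [c1 /code_at_cons[c2 _]] := code_at_cons cat.
  rewrite (run1 _ _ _ c1) /= (run1 _ _ _ c2) /= addn2; eexists; split; first by [].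
  by rewrite /= !eqxx (ltn_eqF vd) rvi; split=> // j /ltn_eqF ->.
- have /code_at_cat[c1 /code_at_cat[c2 /code_at_cons[c3 _]]] := cat.
  have [r1 [run_1 [r1d r1lt]]] := IH1 v d l r rho c1 d0 r0 rv.
  have rv1 i : v i < d.+1 /\ r1 (v i) = enum_rank (rho i).
    by have [vd <-] := rv i; rewrite ltnW // r1lt.
  have [|r2 [run_2 [r2d r2lt]]] := IH2 v d.+1 _ r1 rho c2 isT _ rv1; first by rewrite r1lt.
  rewrite !run_add run_1 run_2 (run1 _ _ _ c3) /=; eexists; split.
    by rewrite !size_cat !addnA addn1.
  rewrite /= eqxx r2d r2lt // r1d; split=> // i id.
  by rewrite (ltn_eqF id) r2lt ?r1lt // ltnW.
- have /code_at_cat[c1 /code_at_cat[c2 /code_at_cons[c3 _]]] := cat.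
  have [r1 [run_1 [r1d r1lt]]] := IH1 v d l r rho c1 d0 r0 rv.
  have rv1 i : v i < d.+1 /\ r1 (v i) = enum_rank (rho i).
    by have [vd <-] := rv i; rewrite ltnW // r1lt.
  have [|r2 [run_2 [r2d r2lt]]] := IH2 v d.+1 _ r1 rho c2 isT _ rv1; first by rewrite r1lt.
  rewrite !run_add run_1 run_2 (run1 _ _ _ c3) /=; eexists; split.
    by rewrite !size_cat !addnA addn1.
  rewrite /= eqxx r2d r2lt // r1d; split=> // i id.
  by rewrite (ltn_eqF id) r2lt ?r1lt // ltnW.
- have /code_at_cat[c1 /code_at_cons[c2 _]] := cat.
  have [r1 [run_1 [r1d r1lt]]] := IH v d l r rho c1 d0 r0 rv.
  rewrite !run_add run_1 (run1 _ _ _ c2) /=; eexists; split.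
    by rewrite size_cat addnA addn1.
  by rewrite /= eqxx r1d; split=> // i id; rewrite (ltn_eqF id) r1lt.
pose x0 (k : nat) (kN : k < N) : G := enum_val (cast_ord (esym cardG) (Ordinal kN)).
pose F k := nth 0 [seq eval e (extend x rho) | x <- enum G] k.
have sE : [seq eval e (extend x rho) | x <- enum G] = map F (iota 0 N).
  by rewrite -(mkseq_nth 0 [seq _ | x <- _]) size_map -cardE cardG.
rewrite sE; apply: (loop_correct cat d0 r0) => k r1 kN r1r r1d.
have cat' : code_at p (l + 4) (compile e (extend d.+1 v) d.+2 (l + 4)).
  by have /code_at_cat[_ /code_at_cat[]] := cat.
have [||i|r2 [run_2 [r2d r2lt]]] := IH (extend d.+1 v) d.+2 (l + 4) r1 (extend (x0 k kN) rho) cat'.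
- by [].
- by rewrite r1r.
- case: i => [i|] /=; last by rewrite ltnSn /x0 enum_valK.
  by have [vd <-] := rv i; rewrite r1r //; split=> //; lia.
exists r2; split=> //; split=> //; rewrite r2d /F (nth_map (x0 k kN)) -?cardE ?cardG //.
by rewrite {1}/x0 (enum_val_nth (x0 k kN)).
Qed.

Lemma time_poly (I : Type) (e : term I) :
  exists q : {poly nat}, forall N, time e N = q.[N]%R.
Proof.
elim: e => {I} [I c|I i|I e1 [q1 IH1] e2 [q2 IH2]|I e1 [q1 IH1] e2 [q2 IH2]|I e [q IH]|I mx e [q IH]] /=.
- by exists 1%:P%R => N; rewrite hornerC.
- by exists 2%:P%R => N; rewrite hornerC.
- by exists (q1 + q2 + 1%:P)%R => N; rewrite !hornerD hornerC IH1 IH2.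
- by exists (q1 + q2 + 1%:P)%R => N; rewrite !hornerD hornerC IH1 IH2.
- by exists (q + 1%:P)%R => N; rewrite !hornerD hornerC IH.
by exists (6%:P + 'X * (q + 6%:P))%R => N; rewrite hornerD hornerM hornerD !hornerC hornerX IH.
Qed.

(** * Definable functions *)

Definition definable (I : Type) (f : forall G : sgraph, (I -> G) -> nat) : Prop :=
  exists e : term I, forall (G : sgraph) (rho : I -> G), eval e rho = f G rho.

Lemma definable_polytime (F : sgraph -> Prop) (chi : sgraph -> nat)
    (f : forall G : sgraph, (void -> G) -> nat) :
  definable f -> (forall G rho, F G -> f G rho = chi G) -> polytime_on F chi.
Proof.
move=> [e fE] fchi; have [q qE] := time_poly e.
pose v (i : void) := 0.
pose c := compile e v 1 0.
exists (c ++ [:: IConst 0 0; IAdd 0 0 1]), (q + 2%:P)%R => G FG.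
pose rho (i : void) : G := of_void G i.
exists (time e #|G| + 2) => s.
have cc : code_at (c ++ [:: IConst 0 0; IAdd 0 0 1]) 0 (c ++ [:: IConst 0 0; IAdd 0 0 1]).
  by exists nil, nil; rewrite /= cats0.
have /code_at_cat[c1 /code_at_cons[k1 /code_at_cons[k2 _]]] := cc.
have [||//|r1 [run_1 [r1d _]]] := compile_correct (erefl #|G|) (rho := rho) c1 (r := reg (input_config G)).
- by [].
- by [].
have sE : s = Config (size c).+2 [eta [eta r1 with 0 |-> 0] with 0 |-> r1 1] (nth 0 (adjacency_matrix G)).
  by rewrite /s run_add run_1 (run1 _ _ _ k1) /= (run1 _ _ _ k2) /= .
split; rewrite ?sE /halted /=; last by rewrite r1d fE fchi.
  by rewrite hornerD hornerC qE.
by rewrite size_cat addn2.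
Qed.

Lemma nth_adjacency_matrix (G : sgraph) (x y : G) :
  nth 0 (adjacency_matrix G) (enum_rank x * #|G| + enum_rank y) = adj x y.
Proof.
have row z : nth 0 [seq nat_of_bool (adj z u) | u <- enum G] (enum_rank y) = adj z y.
  by rewrite (nth_map y) ?nth_enum_rank // -cardE.
have lt_ : enum_rank y < size (enum G) by rewrite -cardE.
suff main (s : seq G) k : k < size s -> nth x s k = x ->
    nth 0 [seq nat_of_bool (adj a b) | a <- s, b <- enum G] (k * #|G| + enum_rank y) = adj x y.
  by apply: main; rewrite ?nth_enum_rank // -cardE.
elim: s k => [|z s IH] [|k] //= ks.
  by move=> zx; rewrite mul0n nth_cat size_map lt_ row zx.
move=> E; rewrite nth_cat size_map -cardE mulSn -addnA ltnNge leq_addr /= addKn.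
exact: IH.
Qed.

Section Definability.
Variable I : Type.
Implicit Types f g : forall G : sgraph, (I -> G) -> nat.
Implicit Types P Q : forall G : sgraph, (I -> G) -> bool.

Lemma definable_const c : definable (fun (G : sgraph) (rho : I -> G) => c).
Proof. by exists (Const _ c). Qed.

Lemma definable_add f g : definable f -> definable g ->
  definable (fun (G : sgraph) (rho : I -> G) => f G rho + g G rho).
Proof. by move=> [e1 E1] [e2 E2]; exists (Add e1 e2) => G rho /=; rewrite E1 E2. Qed.

Lemma definable_sub f g : definable f -> definable g ->
  definable (fun (G : sgraph) (rho : I -> G) => f G rho - g G rho).
Proof. by move=> [e1 E1] [e2 E2]; exists (Sub e1 e2) => G rho /=; rewrite E1 E2. Qed.

Lemma definable_sum (f : forall G : sgraph, (I -> G) -> G -> nat) :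
  definable (fun (G : sgraph) (rho : option I -> G) => f G (fun i => rho (Some i)) (rho None)) ->
  definable (fun (G : sgraph) (rho : I -> G) => \sum_(x : G) f G rho x).
Proof.
move=> [e eE]; exists (Fold false e) => G rho /=.
rewrite (eq_map (g := f G rho)) => [|x]; last by rewrite eE.
by rewrite foldl_idx big_map big_enum.
Qed.

Lemma definable_max (f : forall G : sgraph, (I -> G) -> G -> nat) :
  definable (fun (G : sgraph) (rho : option I -> G) => f G (fun i => rho (Some i)) (rho None)) ->
  definable (fun (G : sgraph) (rho : I -> G) => \max_(x : G) f G rho x).
Proof.
move=> [e eE]; exists (Fold true e) => G rho /=.
rewrite (eq_map (g := f G rho)) => [|x]; last by rewrite eE.
by rewrite foldl_idx big_map big_enum.
Qed.

Lemma definable_ord (i : I) : definable (fun (G : sgraph) (rho : I -> G) => enum_rank (rho i)).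
Proof. by exists (Var i). Qed.

Lemma definable_ext f g : definable f -> (forall G rho, f G rho = g G rho) -> definable g.
Proof. by move=> [e E] fg; exists e => G rho; rewrite E. Qed.

Lemma definable_leq f g : definable f -> definable g ->
  definable (fun (G : sgraph) (rho : I -> G) => f G rho <= g G rho).
Proof.
move=> Df Dg; apply: definable_ext (definable_sub (definable_const 1) (definable_sub Df Dg)) _.
by move=> G rho; rewrite -subn_eq0; case: (f G rho - g G rho).
Qed.

Lemma definable_not P : definable P -> definable (fun (G : sgraph) (rho : I -> G) => ~~ P G rho).
Proof.
move=> DP; apply: definable_ext (definable_sub (definable_const 1) DP) _.
by move=> G rho /=; case: (P G rho).
Qed.

Lemma definable_or P Q : definable P -> definable Q ->
  definable (fun (G : sgraph) (rho : I -> G) => P G rho || Q G rho).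
Proof.
move=> DP DQ; apply: definable_ext (definable_leq (definable_const 1) (definable_add DP DQ)) _.
by move=> G rho /=; case: (P G rho); case: (Q G rho).
Qed.

Lemma definable_imply P Q : definable P -> definable Q ->
  definable (fun (G : sgraph) (rho : I -> G) => P G rho ==> Q G rho).
Proof.
move=> DP DQ; apply: definable_ext (definable_or (definable_not DP) DQ) _.
by move=> G rho /=; rewrite implybE.
Qed.

Lemma definable_and P Q : definable P -> definable Q ->
  definable (fun (G : sgraph) (rho : I -> G) => P G rho && Q G rho).
Proof.
move=> DP DQ; apply: definable_ext (definable_not (definable_imply DP (definable_not DQ))) _.
by move=> G rho /=; case: (P G rho); case: (Q G rho).
Qed.

End Definability.

Section Quantifiers.
Variable I : Type.

Lemma definable_exists (P : forall G : sgraph, (I -> G) -> G -> bool) :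
  definable (fun (G : sgraph) (rho : option I -> G) => P G (fun i => rho (Some i)) (rho None)) ->
  definable (fun (G : sgraph) (rho : I -> G) => [exists x : G, P G rho x]).
Proof.
move=> DP; have := definable_max (f := fun G rho x => P G rho x : nat) DP.
move=> D; apply: definable_ext D _ => G rho; apply/eqP; rewrite eqn_leq; apply/andP; split.
  by apply/bigmax_leqP => x _; case Px: P => //; rewrite lt0b; apply/existsP; exists x.
by case: existsP => // -[x Px]; apply: leq_trans (leq_bigmax x); rewrite Px.
Qed.

Lemma definable_forall (P : forall G : sgraph, (I -> G) -> G -> bool) :
  definable (fun (G : sgraph) (rho : option I -> G) => P G (fun i => rho (Some i)) (rho None)) ->
  definable (fun (G : sgraph) (rho : I -> G) => [forall x : G, P G rho x]).
Proof.
move=> DP; have D := definable_exists (P := fun G rho x => ~~ P G rho x) (definable_not DP).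
apply: definable_ext (definable_not D) _ => G rho; congr nat_of_bool.
by rewrite negb_exists; apply: eq_forallb => x; rewrite negbK.
Qed.

Lemma definable_fsum (T : finType) (p : pred T) (f : T -> forall G : sgraph, (I -> G) -> nat) :
  (forall t, definable (f t)) ->
  definable (fun (G : sgraph) (rho : I -> G) => \sum_(t | p t) f t G rho).
Proof.
move=> Df; suff: forall s : seq T, definable (fun G rho => \sum_(t <- s | p t) f t G rho).
  by move/(_ (index_enum T)).
elim=> [|t s IH]; first by apply: definable_ext (definable_const I 0) _ => G rho; rewrite big_nil.
case pt: (p t); last by apply: definable_ext IH _ => G rho; rewrite big_cons pt.
by apply: definable_ext (definable_add (Df t) IH) _ => G rho; rewrite big_cons pt.
Qed.

Lemma definable_fexists (T : finType) (p : pred T) (P : T -> forall G : sgraph, (I -> G) -> bool) :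
  (forall t, definable (P t)) ->
  definable (fun (G : sgraph) (rho : I -> G) => [exists t : T, p t && P t G rho]).
Proof.
move=> DP; have := definable_leq (definable_const I 1) (definable_fsum p (f := P) DP).
move=> D; apply: definable_ext D _ => G rho; congr nat_of_bool; rewrite lt0n sum_nat_eq0 negb_forall_in.
by apply: eq_existsb => t; rewrite eqb0 negbK.
Qed.

Lemma definable_fforall (T : finType) (p : pred T) (P : T -> forall G : sgraph, (I -> G) -> bool) :
  (forall t, definable (P t)) ->
  definable (fun (G : sgraph) (rho : I -> G) => [forall t : T, p t ==> P t G rho]).
Proof.
move=> DP; have := definable_not (definable_fexists p (fun t => definable_not (DP t))).
move=> D; apply: definable_ext D _ => G rho; congr nat_of_bool; rewrite negb_exists.
by apply: eq_forallb => t; rewrite negb_and negbK -implybE.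
Qed.

Lemma definable_adj (i j : I) : definable (fun (G : sgraph) (rho : I -> G) => adj (rho i) (rho j)).
Proof.
(* Summing the position of [rho i] over all vertices multiplies it by their number. *)
exists (Read (Add (Fold false (Var (Some i))) (Var j))) => G rho /=.
have /= -> : foldl addn 0 [seq enum_rank (extend x rho (Some i)) : nat | x <- enum G]
    = enum_rank (rho i) * #|G|.
  by rewrite foldl_idx big_map big_enum /= sum_nat_const mulnC.
by rewrite nth_adjacency_matrix.
Qed.

End Quantifiers.

Fixpoint rename (I J : Type) (s : I -> J) (e : term I) : term J :=
  match e with
  | Const c => Const J c
  | Var i => Var (s i)
  | Add e1 e2 => Add (rename s e1) (rename s e2)
  | Sub e1 e2 => Sub (rename s e1) (rename s e2)
  | Read e1 => Read (rename s e1)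
  | Fold mx e1 => Fold mx (rename (omap s) e1)
  end.

Lemma eval_rename (G : sgraph) (I J : Type) (e : term I) (s : I -> J) (rho : I -> G) (rho' : J -> G) :
  (forall i, rho' (s i) = rho i) -> eval (rename s e) rho' = eval e rho.
Proof.
elim: e J s rho rho' => {I} [I c|I i|I e1 IH1 e2 IH2|I e1 IH1 e2 IH2|I e IH|I mx e IH] J s rho rho' E /=.
- by [].
- by rewrite E.
- by rewrite (IH1 _ _ rho) // (IH2 _ _ rho).
- by rewrite (IH1 _ _ rho) // (IH2 _ _ rho).
- by rewrite (IH _ _ rho).
by congr foldl; apply: eq_map => x; apply: IH => -[i|] /=.
Qed.

Definition extends (G I : Type) m (x : 'I_m -> G) (rho : I -> G) (i : 'I_m + I) : G :=
  match i with inl a => x a | inr b => rho b end.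

(** A maximum over [m]-tuples of vertices is an [m]-fold iterated maximum over vertices. *)
Lemma eval_bigmax m (I : Type) (e : term ('I_m + I)) :
  exists e' : term I, forall (G : sgraph) (rho : I -> G),
    eval e' rho = \max_(x : {ffun 'I_m -> G}) eval e (extends x rho).
Proof.
elim: m I e => [|m IHm] I e.
  pose none (T : Type) (i : 'I_0) : T := False_rect T (notF (ltn_ord i)).
  exists (rename (fun s => match s with inl i => none I i | inr b => b end) e) => G rho.
  have E x : eval (rename (fun s => match s with inl i => none I i | inr b => b end) e) rho
      = eval e (extends x rho) by apply: eval_rename => -[[]|].
  apply/eqP; rewrite eqn_leq; apply/andP; split.
    by rewrite (E [ffun i => none G i]) leq_bigmax.
  by apply/bigmax_leqP => x _; rewrite (E x).
pose s (i : 'I_m.+1 + I) : 'I_m + option I :=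
  match i with
  | inl a => if unlift ord0 a is Some b then inl b else inr None
  | inr b => inr (Some b)
  end.
have [e1 e1E] := IHm (option I) (rename s e).
exists (Fold true e1) => G rho /=.
rewrite foldl_idx big_map big_enum /=.
apply/eqP; rewrite eqn_leq; apply/andP; split; apply/bigmax_leqP => x _.
  rewrite e1E; apply/bigmax_leqP => y _.
  pose z : {ffun 'I_m.+1 -> G} := [ffun a : 'I_m.+1 => if unlift ord0 a is Some b then y b else x].
  apply: (bigmax_sup z) => //; rewrite (@eval_rename _ _ _ _ _ (extends z rho)) //.
  by case=> [a|b] //=; rewrite ffunE; case: (unlift ord0 a).
apply: (bigmax_sup (x ord0)) => //; rewrite e1E.
apply: (bigmax_sup [ffun b : 'I_m => x (lift ord0 b) : G]) => //.
rewrite (@eval_rename _ _ _ _ _ (extends x rho)) //.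
by case=> [a|b] //=; case: unliftP => [b|] ->; rewrite /= ?ffunE.
Qed.

Lemma definable_bigmax m (I : Type) (f : forall G : sgraph, ('I_m -> G) -> (I -> G) -> nat) :
  definable (fun (G : sgraph) (rho : 'I_m + I -> G) => f G (fun a => rho (inl a)) (fun i => rho (inr i))) ->
  definable (fun (G : sgraph) (rho : I -> G) => \max_(x : {ffun 'I_m -> G}) f G x rho).
Proof.
move=> [e eE]; have [e' e'E] := eval_bigmax e.
by exists e' => G rho; rewrite e'E; apply: eq_bigr => x _; rewrite eE.
Qed.

(** * The chromatic number as a counting term *)

Section DefinableCore.
Variable m : nat.

Lemma definable_clique_tuple (I : Type) (q : 'I_m -> I) :
  definable (fun (G : sgraph) (rho : I -> G) => clique_tuple (fun a => rho (q a))).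
Proof.
apply: (definable_fforall xpredT) => a; apply: (definable_fforall (fun b => a != b)) => b.
exact: definable_adj.
Qed.

Lemma definable_core (I : Type) (q : 'I_m -> I) (u : I) :
  definable (fun (G : sgraph) (rho : I -> G) => core (fun a => rho (q a)) (rho u)).
Proof.
apply: definable_leq; last exact: definable_const.
apply: (definable_fsum xpredT) => a.
exact/definable_not/definable_adj.
Qed.

Lemma definable_below (I : Type) (q : 'I_m -> I) (u v : I) :
  definable (fun (G : sgraph) (rho : I -> G) => below (fun a => rho (q a)) (rho u) (rho v)).
Proof.
apply: definable_forall; apply: definable_imply; first exact: definable_core.
apply: definable_imply; exact: definable_adj.
Qed.

Lemma definable_top (I : Type) (q : 'I_m -> I) (u : I) :
  definable (fun (G : sgraph) (rho : I -> G) => top (fun a => rho (q a)) (rho u)).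
Proof.
apply: definable_and; first exact: definable_core.
apply: definable_forall; apply: definable_imply; first exact: definable_core.
apply: definable_imply; first exact/definable_not/definable_adj.
exact: definable_below.
Qed.

Lemma definable_top_rep (I : Type) (q : 'I_m -> I) (u : I) :
  definable (fun (G : sgraph) (rho : I -> G) => top_rep (fun a => rho (q a)) (rho u)).
Proof.
apply: definable_and; first exact: definable_top.
apply: definable_forall; apply: definable_imply; first exact: definable_top.
apply: definable_imply; last exact: definable_adj.
apply: definable_leq; last exact: definable_ord.
by apply: (@definable_add _ (fun G rho => 1)); [apply: definable_const | apply: definable_ord].
Qed.

End DefinableCore.

Lemma definable_in_class k (I : Type) (x : 'I_k -> 'I_k -> I) (i : 'I_k) (u : I) :
  definable (fun (G : sgraph) (rho : I -> G) => in_class (fun a b => rho (x a b)) i (rho u)).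
Proof.
apply: definable_and.
  apply: (definable_fforall (fun j : 'I_k => j < i)) => j.
  exact: definable_adj.
apply: (definable_fforall (fun j : 'I_k => i < j)) => j.
exact/definable_not/definable_adj.
Qed.

Lemma definable_classes_color k (I : Type) (x : 'I_k -> 'I_k -> I) :
  definable (fun (G : sgraph) (rho : I -> G) => classes_color (fun a b => rho (x a b))).
Proof.
apply: definable_and; apply: definable_forall.
  apply: (definable_fexists xpredT) => i.
  exact: (definable_in_class (fun a b => Some (x a b)) i None).
apply: definable_forall; apply: definable_imply; first exact: definable_adj.
apply: (definable_fforall xpredT) => i.
apply/definable_not/definable_and.
  exact: (definable_in_class (fun a b => Some (Some (x a b))) i (Some None)).
exact: (definable_in_class (fun a b => Some (Some (x a b))) i None).
Qed.

Lemma definable_exists_ffun m (I : Type) (P : forall G : sgraph, ('I_m -> G) -> (I -> G) -> bool) :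
  definable (fun (G : sgraph) (rho : 'I_m + I -> G) =>
    P G (fun a => rho (inl a)) (fun i => rho (inr i))) ->
  definable (fun (G : sgraph) (rho : I -> G) => [exists x : {ffun 'I_m -> G}, P G x rho]).
Proof.
move=> DP; have D := definable_bigmax (f := fun G x rho => P G x rho : nat) DP.
apply: definable_ext D _ => G rho; apply/eqP; rewrite eqn_leq; apply/andP; split.
  by apply/bigmax_leqP => x _; case Px: (P G x rho) => //; rewrite lt0b; apply/existsP; exists x.
by case: existsP => // -[x Px]; apply: (bigmax_sup x) => //; rewrite Px.
Qed.

Lemma definable_class_test k (I : Type) :
  definable (fun (G : sgraph) (rho : I -> G) => class_test G k).
Proof.
apply: (definable_exists_ffun (P := fun G x rho => classes_color (fun i j => x (enum_rank (i, j))))).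
exact: (definable_classes_color (fun i j => inl (enum_rank (i, j)))).
Qed.

Definition has_clique m (G : sgraph) : bool := [exists q : {ffun 'I_m -> G}, clique_tuple q].

Lemma has_cliqueP m (G : sgraph) :
  reflect (exists2 K : {set G}, clique K & m <= #|K|) (has_clique m G).
Proof.
apply: (iffP existsP) => [[q cq]|[K cK mK]]; last by have [q] := clique_tuple_in cK mK; exists q.
exists (q @: setT); first exact: clique_tuple_imset.
by rewrite card_imset ?cardsT ?card_ord //; apply: clique_tuple_inj.
Qed.

(** The first summand is the clique number if [G] has a clique with [m] vertices, and 0
    otherwise. The second one is 0 in the first case, and otherwise it counts the numbers of
    colours that are too small. On the graph without vertices [class_test] fails for
    all [k > 0], whence the condition that there is a vertex. *)
Definition chromatic_term (m : nat) (G : sgraph) : nat :=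
  \max_(q : {ffun 'I_m -> G}) \sum_(u : G) (clique_tuple q && top_rep q u)
  + \sum_(k < 3 ^ m) ([exists u : G, true] && (~~ has_clique m G && ~~ class_test G k)).

Lemma definable_chromatic_term m (I : Type) :
  definable (fun (G : sgraph) (rho : I -> G) => chromatic_term m G).
Proof.
apply: definable_add.
  apply: (definable_bigmax (f := fun G q rho => \sum_(u : G) (clique_tuple q && top_rep q u))).
  apply: definable_sum; apply: definable_and; first exact: definable_clique_tuple.
  exact: definable_top_rep.
apply: (definable_fsum xpredT) => k; apply: definable_and.
  by apply: definable_exists; apply: definable_const _ (true : nat).
apply: definable_and; apply: definable_not; last exact: definable_class_test.
apply: (definable_exists_ffun (P := fun G q rho => clique_tuple q)).
exact: definable_clique_tuple.
Qed.

Lemma colorable_card (G : sgraph) : colorable G #|G|.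
Proof.
apply/existsP; exists [ffun x => enum_rank x].
apply/forallP => x; apply/forallP => y; apply/implyP => xy; rewrite !ffunE.
by apply: contraTneq xy => /enum_rank_inj ->; rewrite adj_irr.
Qed.

Lemma sum_bool (T : finType) (P : pred T) : \sum_(x : T) P x = #|[set x | P x]|.
Proof. by rewrite -sum1dep_card [RHS]big_mkcond; apply: eq_bigr => x _; case: (P x). Qed.

Lemma sum_ltn R c : \sum_(k < R) (k < c) = minn R c.
Proof.
elim: R => [|R IH]; first by rewrite big_ord0 min0n.
by rewrite big_ord_recr /= IH; case: ltnP; lia.
Qed.

Lemma chromatic_termE n (G : sgraph) : two_K2_free G -> P4_join_free G n ->
  chromatic_term (4 * n + 4) G = chromatic_number G.
Proof.
move=> G2 G4; rewrite /chromatic_term; set m := 4 * n + 4.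
have nm : n + 4 <= m by rewrite /m; lia.
have [big|small] := boolP (has_clique m G).
  rewrite [X in _ + X]big1 ?addn0 => [|k _]; last by rewrite andbF.
  have /has_cliqueP[Q cQ Q_big] := big.
  have [K [cK K_max ->]] := chromatic_number_clique G2 G4 cQ Q_big.
  apply/eqP; rewrite eqn_leq; apply/andP; split.
    apply/bigmax_leqP => q _; case cq: (clique_tuple q); last by rewrite big1.
    by rewrite sum_bool; apply: K_max; apply: clique_top_rep.
  have mK : m <= #|K| := leq_trans Q_big (K_max Q cQ).
  have [q cq qK] := clique_tuple_in cK mK.
  apply: (bigmax_sup q) => //; rewrite cq sum_bool.
  exact: leq_card_top_rep nm cq cK qK.
rewrite big1 ?add0n => [|q _]; last first.
  case cq: (clique_tuple q); last by rewrite big1.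
  by case/existsP: small; exists q.
have [G0|G0] := posnP #|G|.
  rewrite big1 => [|k _].
    by apply/esym/eqP; rewrite -leqn0 -G0 -colorableE colorable_card.
  by case: existsP => // -[u _]; have := max_card (pred1 u); rewrite card1 G0.
have [u _] := card_gt0P G0.
have chi_le : chromatic_number G <= 3 ^ m.
  rewrite -colorableE; apply: colorable_bounded_clique => // K cK.
  by apply: contraR small; rewrite -ltnNge => mK; apply/has_cliqueP; exists K => //; apply: ltnW.
rewrite -[RHS](minn_idPr chi_le) -sum_ltn; apply: eq_bigr => k _.
have -> : [exists u : G, true] by apply/existsP; exists u.
by rewrite class_testE // colorableE -ltnNge.
Qed.

Theorem theorem3 (n : nat) (hn : 0 < n) :
  chromatic_number_polytime
    (pair_free (disjoint_union (complete 2) (complete 2))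
               (graph_join (path_graph 4) (complete n))).
Proof.
apply: (definable_polytime (definable_chromatic_term (4 * n + 4) void)).
move=> G rho [/two_K2_freeP G2 /P4_join_freeP G4].
exact: chromatic_termE.
Qed.
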